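(* Let $k\in\mathbb{N}$ and let $G$ be a $k$-tree on $n$ vertices. Then $$\gamma_i(G)\leq \frac{n+|V_k^G|}{k+2},$$ where $V_k^G=\{v\in V(G): \deg_G(v)=k\}$. Furthermore, this bound is tight: for every $k\in\mathbb{N}$ there exist $k$-trees $G$ for which equality holds.
   Context: All graphs are simple and finite. For $k\in\mathbb{N}$, a $k$-tree is defined recursively: the complete graph $K_{k+1}$ is a $k$-tree, and if $G$ is a $k$-tree then the graph obtained by adding a new vertex and joining it to all vertices of some $k$-clique (complete subgraph on $k$ vertices) of $G$ is a $k$-tree. A set $D\subseteq V(G)$ is dominating if every vertex of $V(G)\setminus D$ is adjacent to a vertex of $D$; the independent domination number $\gamma_i(G)$ is the minimum cardinality of a set that is both independent and dominating in $G$. *)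

(* Defs.v *)
From HB Require Import structures.
From mathcomp Require Import all_boot all_order all_algebra.

Set Implicit Arguments.
Unset Strict Implicit.
Unset Printing Implicit Defensive.

Record sgraph : Type := SGraph {
  vertex :> finType;
  adj : rel vertex;
  adj_sym : symmetric adj;
  adj_irr : irreflexive adj }.

Definition graph_iso (G H : sgraph) : Prop :=
  exists2 f : G -> H, bijective f & forall x y : G, adj (f x) (f y) = adj x y.

Definition complete_rel n : rel 'I_n := fun x y => x != y.

Lemma complete_sym n : symmetric (@complete_rel n).
Proof. by move=> x y; rewrite /complete_rel eq_sym. Qed.

Lemma complete_irr n : irreflexive (@complete_rel n).
Proof. by move=> x; rewrite /complete_rel eqxx. Qed.

Definition complete_graph n : sgraph :=
  SGraph (@complete_sym n) (@complete_irr n).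

(* [None] is the new vertex; its neighbourhood is Q. *)
Definition add_vertex_rel (G : sgraph) (Q : {set G}) : rel (option G) :=
  fun x y => match x, y with
             | Some u, Some v => adj u v
             | Some u, None | None, Some u => u \in Q
             | None, None => false
             end.

Lemma add_vertex_sym (G : sgraph) (Q : {set G}) :
  symmetric (add_vertex_rel Q).
Proof. by case=> [x|] [y|] //=; apply: adj_sym. Qed.

Lemma add_vertex_irr (G : sgraph) (Q : {set G}) :
  irreflexive (add_vertex_rel Q).
Proof. by case=> [x|] //=; apply: adj_irr. Qed.

Definition add_vertex (G : sgraph) (Q : {set G}) : sgraph :=
  SGraph (add_vertex_sym Q) (add_vertex_irr Q).

Section GraphNotions.
Variable G : sgraph.
Implicit Types (Q D : {set G}) (v : G).

Definition clique Q : bool :=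
  [forall x in Q, forall y in Q, (x != y) ==> adj x y].

Definition independent D : bool :=
  [forall x in D, forall y in D, ~~ adj x y].

Definition dominating D : bool :=
  [forall v in ~: D, exists u in D, adj v u].

Definition degree v : nat := #|[set u | adj v u]|.

Definition degree_set (d : nat) : {set G} := [set v | degree v == d].

Definition ids_of_card (m : nat) : bool :=
  [exists D : {set G}, [&& independent D, dominating D & #|D| == m]].

(* A maximum independent set is dominating. *)
Lemma ids_exists : exists m, ids_of_card m.
Proof.
have ind0 : independent set0 by apply/forall_inP=> x; rewrite inE.
case: (arg_maxnP (fun D : {set G} => #|D|) ind0) => D indD maxD.
exists #|D|; apply/existsP; exists D; rewrite indD eqxx andbT /=.
apply/forall_inP=> v; rewrite inE => vD.
apply: contraT; rewrite negb_exists_in => /forall_inP nadj.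
have indvD : independent (v |: D).
  apply/forall_inP=> x /setU1P [->|xD]; apply/forall_inP=> y /setU1P [->|yD].
  - by rewrite adj_irr.
  - exact: nadj.
  - by rewrite adj_sym nadj.
  - exact: (forall_inP (forall_inP indD x xD)).
by have := maxD _ indvD; rewrite cardsU1 vD add1n /= ltnn.
Qed.

(* The independent domination number. *)
Definition gamma_i : nat := ex_minn ids_exists.

End GraphNotions.

Inductive is_ktree (k : nat) : sgraph -> Prop :=
| ktree_complete : is_ktree k (complete_graph k.+1)
| ktree_add (G : sgraph) (Q : {set G}) :
    is_ktree k G -> clique Q -> #|Q| = k -> is_ktree k (add_vertex Q)
(* Graphs are considered up to isomorphism. *)
| ktree_iso (G H : sgraph) : is_ktree k G -> graph_iso G H -> is_ktree k H.

(* Main.v *)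
Require Import Defs.
From mathcomp Require Import all_boot all_order all_algebra.
From mathcomp Require Import zify.

(* Every k-tree has a proper colouring with k+2 colours in which each vertex
   misses at most one colour in its closed neighbourhood, and only vertices of
   degree k miss one. A new vertex attached to a clique Q receives the colour
   missed by the vertices of Q, if there is one, so that the vertices of Q no
   longer miss any. Extending each of the k+2 colour classes greedily to an
   independent dominating set only adds vertices missing that colour, so these
   k+2 sets have total size at most n + |V_k|. The k-th power of the path on
   2k+2 vertices attains the bound: no vertex dominates both ends. *)

Set Implicit Arguments.
Unset Strict Implicit.
Unset Printing Implicit Defensive.

Import Order.TTheory GRing.Theory Num.Theory.
Local Open Scope nat_scope.

(** * Independent domination number and greedy extension of independent sets *)

Lemma gamma_i_le (G : sgraph) (D : {set G}) :
  independent D -> dominating D -> gamma_i G <= #|D|.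
Proof.
move=> indD domD; rewrite /gamma_i; case: ex_minnP => m _; apply.
by apply/existsP; exists D; rewrite indD domD eqxx.
Qed.

Lemma gamma_i_witness (G : sgraph) :
  exists D : {set G}, dominating D /\ #|D| = gamma_i G.
Proof.
rewrite /gamma_i; case: ex_minnP => m /existsP[D /and3P[_ domD /eqP cardD]] _.
by exists D.
Qed.

(** A largest independent set containing [A] is dominating, and what it adds to [A] has no neighbour
    in [A]. *)
Lemma gamma_i_greedy (G : sgraph) (A : {set G}) : independent A ->
  gamma_i G <= #|A| + #|[set x in ~: A | [forall y in A, ~~ adj x y]]|.
Proof.
move=> indA; set U := [set x in _ | _].
pose P (D : {set G}) := independent D && (A \subset D).
have PA : P A by rewrite /P indA subxx.
case: (arg_maxnP (fun D : {set G} => #|D|) PA) => D /andP[indD AD] maxD.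
have adjD x y : x \in D -> y \in D -> ~~ adj x y.
  by move=> xD; apply: (forall_inP (forall_inP indD x xD)).
have domD : dominating D.
  apply/forall_inP=> v; rewrite inE => vD.
  apply: contraT; rewrite negb_exists_in => /forall_inP nadj.
  have PvD : P (v |: D).
    rewrite /P (subset_trans AD (subsetU1 _ _)) andbT.
    apply/forall_inP=> x /setU1P [->|xD]; apply/forall_inP=> y /setU1P [->|yD].
    - by rewrite adj_irr.
    - exact: nadj.
    - by rewrite adj_sym nadj.
    - exact: adjD.
  by have := maxD _ PvD; rewrite cardsU1 vD add1n /= ltnn.
apply: leq_trans (gamma_i_le indD domD) _.
apply: leq_trans (leq_card_setU A U); apply/subset_leq_card/subsetP => x xD.
rewrite !inE; case: (boolP (x \in A)) => //= _.
by apply/forall_inP=> y yA; apply: adjD => //; apply: (subsetP AD).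
Qed.

(** * Good colourings and the bound they imply *)

Section Colouring.
Variables (k : nat) (G : sgraph).
Implicit Types (col : G -> 'I_k.+2) (c : 'I_k.+2).

(** These [x] are exactly the vertices that a greedy extension of the colour class of [c] may
    add. *)
Definition missing col c (x : G) : bool :=
  (col x != c) && [forall y, adj x y ==> (col y != c)].

Lemma missingP col c x :
  reflect (col x <> c /\ forall y, adj x y -> col y <> c) (missing col c x).
Proof.
apply: (iffP andP) => [[/eqP nx /forallP ny]|[nx ny]]; split=> //.
- by move=> y xy; apply/eqP; apply: implyP (ny y) xy.
- exact/eqP.
- by apply/forallP => y; apply/implyP => /ny /eqP.
Qed.

(** In the last clause, [x = y] says that a vertex misses at most one colour. The adjacent case
    makes all vertices of a clique that miss a colour miss the same one, which is what the induction
    over k-trees needs. *)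
Definition good_colouring col : Prop :=
  [/\ forall x y, adj x y -> col x <> col y,
      forall x c, missing col c x -> degree x = k
    & forall x y c c', x = y \/ adj x y ->
        missing col c x -> missing col c' y -> c = c'].

Lemma good_colouring_bound col : good_colouring col ->
  gamma_i G * k.+2 <= #|G| + #|degree_set G k|.
Proof.
case=> proper missdeg missuniq.
pose A c := [set x | col x == c].
have bound c : gamma_i G <= #|A c| + #|[set x | missing col c x]|.
  have indA : independent (A c).
    apply/forall_inP=> x; rewrite inE => /eqP cx.
    apply/forall_inP=> y; rewrite inE => /eqP cy.
    by apply/negP=> /proper; rewrite cx cy.
  apply: leq_trans (gamma_i_greedy indA) _; rewrite leq_add2l.
  apply/subset_leq_card/subsetP => x; rewrite !inE /missing => /andP[-> /=].
  move/forall_inP=> nadj; apply/forallP=> y; apply/implyP=> xy.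
  by apply: contraL xy => cy; apply: nadj; rewrite inE.
have -> : gamma_i G * k.+2 = \sum_(c < k.+2) gamma_i G.
  by rewrite sum_nat_const card_ord mulnC.
apply: (@leq_trans (\sum_c (#|A c| + #|[set x | missing col c x]|))).
  by apply: leq_sum => c _; apply: bound.
rewrite big_split /=.
apply: leq_add.
  rewrite -[#|G|]sum1_card (partition_big col xpredT) //=.
  by apply: leq_sum => c _; rewrite -sum1dep_card.
(* Pairs of a colour and a vertex missing it are now counted by vertex: each contributes at most 1,
   and 0 unless its degree is [k]. *)
under eq_bigr => c _ do rewrite -sum1dep_card big_mkcond.
rewrite exchange_big /= -sum1dep_card [X in _ <= X]big_mkcond.
apply: leq_sum => x _; rewrite -big_mkcond sum1dep_card.
case: (set_0Vmem [set c | missing col c x]) => [->|[c]]; first by rewrite cards0.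
rewrite inE => mc; rewrite (missdeg _ _ mc) eqxx -(cards1 c).
apply/subset_leq_card/subsetP => c'; rewrite !inE => mc'.
by apply/eqP/(missuniq x x) => //; left.
Qed.

End Colouring.

(** * Good colourings of k-trees, by induction on the construction *)

Lemma good_colouring_iso k (G H : sgraph) : graph_iso G H ->
  (exists col, @good_colouring k G col) -> exists col, @good_colouring k H col.
Proof.
case=> f [g fK gK] fadj [col [proper missdeg missuniq]].
have gadj x y : adj (g x) (g y) = adj x y by rewrite -fadj !gK.
have gmiss c x : missing (col \o g) c x -> missing col c (g x).
  case/missingP=> nx ny; apply/missingP; split=> // y.
  by rewrite -fadj gK => /ny /=; rewrite fK.
exists (col \o g); split=> [x y xy|x c /gmiss /missdeg <-|x y c c' xy].
- by apply: proper; rewrite gadj.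
- rewrite /degree -(card_imset _ (can_inj gK)); apply: eq_card => y.
  by rewrite -[y]fK (mem_imset _ _ (can_inj gK)) !inE gadj.
- move=> /gmiss mx /gmiss my; apply: missuniq mx my.
  by case: xy => [->|xy]; [left|right; rewrite gadj].
Qed.

(** The vertices receive distinct colours, so the only colour left to miss is the last one,
    [ord_max], and every vertex has degree [k]. *)
Lemma good_colouring_complete k :
  exists col, @good_colouring k (complete_graph k.+1) col.
Proof.
pose col (x : complete_graph k.+1) : 'I_k.+2 := widen_ord (leqnSn _) x.
have miss c x : missing col c x -> c = ord_max.
  case/missingP=> nx ny; apply/val_inj/eqP => /=.
  rewrite eqn_leq -ltnS ltn_ord /= leqNgt; apply/negP => ltc.
  pose y : complete_graph k.+1 := Ordinal ltc.
  have cy : col y = c by apply: val_inj.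
  case: (altP (x =P y)) => [xy|xy]; first by case: nx; rewrite xy.
  exact: (ny y).
exists col; split=> [x y xy exy|x c _|x y c c' _ /miss -> /miss -> //].
- by case/eqP: xy; apply: val_inj; case: exy.
- have -> : degree x = #|[set~ x]|.
    by apply: eq_card => y; rewrite !inE eq_sym.
  by rewrite cardsC1 card_ord.
Qed.

Lemma good_colouring_add k (G : sgraph) (Q : {set G}) :
  clique Q -> #|Q| = k -> (exists col, @good_colouring k G col) ->
  exists col, @good_colouring k (add_vertex Q) col.
Proof.
move=> clQ cardQ [col [proper missdeg missuniq]].
have adjQ x y : x \in Q -> y \in Q -> x = y \/ adj x y.
  move=> xQ yQ; case: (altP (x =P y)) => xy; [by left|right].
  exact: (implyP (forall_inP (forall_inP clQ x xQ) y yQ)).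
(* Of the two colours absent from [Q], one goes to the new vertex and the other is the only one it
   can miss. *)
have card_colQ : #|~: (col @: Q)| = 2.
  have : #|col @: Q| = k.
    rewrite card_in_imset // => x y xQ yQ.
    by case: (adjQ x y xQ yQ) => // /proper.
  by have := cardsC (col @: Q); rewrite card_ord; lia.
have [cv cvQ cvmiss] : exists2 cv, cv \notin col @: Q &
    forall x c, x \in Q -> missing col c x -> c = cv.
  case: (boolP [exists c, [exists x in Q, missing col c x]]).
    case/existsP=> c /exists_inP[x xQ mx]; exists c.
      apply/imsetP=> -[y yQ cy]; case/missingP: mx => nx ny.
      case: (adjQ x y xQ yQ) => [xy|/ny]; last by rewrite cy.
      by case: nx; rewrite xy.
    by move=> y c' yQ my; apply: missuniq my mx; apply: adjQ.
  (* No vertex of [Q] misses a colour, so either free colour will do. *)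
  rewrite negb_exists => /forallP none.
  have : 0 < #|~: (col @: Q)| by rewrite card_colQ.
  case/card_gt0P=> c; rewrite inE => cQ; exists c => // x c' xQ mx.
  by case/exists_inP: (none c'); exists x.
pose col' (x : add_vertex Q) := if x is Some u then col u else cv.
(* A vertex of [Q] could only have missed [cv], which it now sees on the new vertex. *)
have missSome c u : missing col' c (Some u : add_vertex Q) ->
    u \notin Q /\ missing col c u.
  case/missingP=> nx ny; have mu : missing col c u.
    by apply/missingP; split=> // y uy; apply: (ny (Some y)).
  split=> //; apply/negP=> uQ.
  by apply: (ny None uQ); rewrite (cvmiss u c).
have missNone c : missing col' c (None : add_vertex Q) ->
    c \notin cv |: col @: Q.
  case/missingP=> /= nx ny; rewrite !inE negb_or; apply/andP; split.
    by apply/eqP => cE; apply: nx; rewrite cE.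
  by apply/imsetP=> -[y yQ cy]; apply: (ny (Some y)) => //=; rewrite cy.
have missNone_uniq c c' : missing col' c (None : add_vertex Q) ->
    missing col' c' (None : add_vertex Q) -> c = c'.
  move=> /missNone mc /missNone mc'.
  have : #|~: (cv |: col @: Q)| <= 1.
    have := cardsC (cv |: col @: Q); have := cardsC (col @: Q).
    by rewrite cardsU1 cvQ; lia.
  by move/card_le1_eqP; apply; rewrite inE.
have injS : injective (@Some G) by move=> x y [].
exists col'; split.
- have cvNQ u : u \in Q -> col u <> cv.
    by move=> uQ cu; move/negP: cvQ; apply; rewrite -cu imset_f.
  case=> [u|] [w|] //=; first exact: proper.
  + exact: cvNQ.
  + by move=> wQ cw; apply: (cvNQ w).
(* An old vertex still missing a colour lies outside [Q], so its degree is unchanged; the new vertex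
   has degree [#|Q|]. *)
- case=> [u|] c.
    case/missSome=> uQ /missdeg <-.
    rewrite /degree -(card_imset _ injS); apply: eq_card => -[w|].
      by rewrite (mem_imset _ _ injS) !inE.
    by rewrite !inE /= (negbTE uQ); apply/esym/imsetP=> -[].
  move=> _; rewrite -[RHS]cardQ /degree -(card_imset _ injS).
  apply: eq_card => -[w|].
    by rewrite (mem_imset _ _ injS) !inE.
  by rewrite !inE /=; apply/esym/imsetP=> -[].
- case=> [u|] [w|] c c'.
  + move=> uw /missSome[_ mu] /missSome[_ mw]; apply: missuniq mu mw.
    by case: uw => [[->]|uw]; [left|right].
  (* The neighbours of the new vertex lie in [Q] and miss nothing, so the mixed cases are
     vacuous. *)
  + by case=> //= uQ /missSome[]; rewrite uQ.
  + by case=> //= wQ _ /missSome[]; rewrite wQ.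
  + by move=> _; apply: missNone_uniq.
Qed.

Lemma ktree_good_colouring k (G : sgraph) :
  is_ktree k G -> exists col, @good_colouring k G col.
Proof.
elim=> [|{}G Q _ IH clQ cardQ|{}G H _ IH GH].
- exact: good_colouring_complete.
- exact: good_colouring_add.
- exact: good_colouring_iso GH IH.
Qed.

Lemma ktree_gamma_i_bound k (G : sgraph) : is_ktree k G ->
  gamma_i G * k.+2 <= #|G| + #|degree_set G k|.
Proof. by case/ktree_good_colouring=> col; apply: good_colouring_bound. Qed.

(** * Tightness: powers of paths *)

Definition path_power_rel k n : rel 'I_n :=
  fun x y => [&& x != y, x <= y + k & y <= x + k].

Lemma path_power_sym k n : symmetric (@path_power_rel k n).
Proof. by move=> x y; rewrite /path_power_rel eq_sym [(x <= _) && _]andbC. Qed.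

Lemma path_power_irr k n : irreflexive (@path_power_rel k n).
Proof. by move=> x; rewrite /path_power_rel eqxx. Qed.

Definition path_power k n : sgraph :=
  SGraph (@path_power_sym k n) (@path_power_irr k n).

(** On [k.+1] vertices the graph is complete. Beyond that, the last vertex is joined to exactly the
    [k] vertices before it, which form a clique. *)
Lemma path_power_ktree k m : is_ktree k (path_power k (m + k).+1).
Proof.
elim: m => [|m IH].
  apply: ktree_iso (ktree_complete k) _; exists id; first by exists id.
  move=> x y; rewrite /= /path_power_rel /complete_rel; case: eqP => //= _.
  have le_k (u v : 'I_k.+1) : u <= v + k by have := ltn_ord u; lia.
  by apply/andP; split; apply: le_k.
pose Q := [set x : path_power k (m + k).+1 | m < x].
have clQ : clique Q.
  apply/forall_inP=> x; rewrite inE => mx; apply/forall_inP=> y.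
  rewrite inE => my; apply/implyP=> xy; rewrite /= /path_power_rel xy /=.
  by have := ltn_ord x; have := ltn_ord y; lia.
have cardQ : #|Q| = k.
  rewrite -[RHS]card_ord -(card_imset predT (@rshift_inj m.+1 k)).
  apply: eq_card => x; rewrite inE; apply/idP/imsetP=> [mx|[i _ ->]]; last first.
    by rewrite /= leq_addr.
  have ltk : x - m.+1 < k by have := ltn_ord x; lia.
  by exists (Ordinal ltk) => //; apply: val_inj; rewrite /= subnKC.
apply: ktree_iso (ktree_add IH clQ cardQ) _.
pose f (x : add_vertex Q) : path_power k (m.+1 + k).+1 :=
  if x is Some u then widen_ord (leqnSn (m + k).+1) u else ord_max.
exists f.
  apply: inj_card_bij; last by rewrite /= card_option !card_ord.
  case=> [u|] [w|] //= [E]; first by congr Some; apply: val_inj.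
  - by have := ltn_ord u; rewrite E; lia.
  - by have := ltn_ord w; rewrite -E; lia.
case=> [u|] [w|] //=; rewrite /path_power_rel -?val_eqE /= ?inE.
- by have := ltn_ord u; lia.
- by have := ltn_ord w; lia.
- by rewrite eqxx.
Qed.

Lemma path_power_gamma_i k : 2 <= gamma_i (path_power k (k + k).+2).
Proof.
have [D [/forall_inP domD <-]] := gamma_i_witness (path_power k (k + k).+2).
have dom v : exists2 u, u \in D & (v == u) || adj v u.
  case: (boolP (v \in D)) => vD; first by exists v; rewrite ?eqxx.
  have [|u uD vu] := exists_inP (domD v _); first by rewrite inE.
  by exists u; rewrite ?vu ?orbT.
have [u uD u0] := dom ord0; have [w wD w1] := dom ord_max.
apply: leq_trans (_ : #|[set u; w]| <= _); last first.
  by apply/subset_leq_card/subsetP => x /set2P[] ->.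
rewrite cards2; case: eqP => // uw; subst w.
(* A common dominator would be within [k] of both [0] and [2k+1]. *)
by move: u0 w1; rewrite /= /path_power_rel -!val_eqE /=; lia.
Qed.

(** The closed neighbourhood of an inner vertex contains [k+2] consecutive vertices: the first half
    of the path if [x <= k], the window starting at [k] otherwise. *)
Lemma path_power_degree k (x : path_power k (k + k).+2) :
  0 < x < (k + k).+1 -> k < degree x.
Proof.
move=> xint; pose l := if x <= k then 0 else k.
have llek : l <= k by rewrite /l; case: ifP.
(* Since [l + i <= 2k+1], the default value of [inord] never occurs. *)
pose h (i : 'I_k.+2) : path_power k (k + k).+2 := inord (l + i).
have hE i : h i = l + i :> nat by rewrite inordK //; have := ltn_ord i; lia.
have injh : injective h.
  by move=> i j E; apply/val_inj/(@addnI l); rewrite -!hE E.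
have : #|h @: predT| <= #|x |: [set u | adj x u]|.
  apply/subset_leq_card/subsetP => y /imsetP[i _ ->]; rewrite !inE eq_sym.
  case: eqP => //= /eqP nx; rewrite /path_power_rel nx hE /=.
  by have := ltn_ord i; rewrite /l; case: ifP; lia.
by rewrite card_imset // card_ord cardsU1 inE adj_irr /degree.
Qed.

Lemma path_power_degree_set k :
  #|degree_set (path_power k (k + k).+2) k| <= 2.
Proof.
apply: leq_trans (_ : #|[set ord0; ord_max] : {set 'I_(k + k).+2}| <= _).
  apply/subset_leq_card/subsetP => x; rewrite !inE => /eqP dx.
  have := @path_power_degree k x; rewrite dx ltnn -!val_eqE /=.
  by have := ltn_ord x; case: (nat_of_ord x) => //= j; lia.
by rewrite cards2; case: eqP.
Qed.

Local Open Scope ring_scope.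

Theorem theorem3 (k : nat) :
  (forall (n : nat) (G : sgraph), is_ktree k G -> #|G| = n ->
     (gamma_i G)%:R <= (n%:R + #|degree_set G k|%:R) / (k%:R + 2%:R) :> rat)
  /\ (exists G : sgraph, is_ktree k G /\
       (gamma_i G)%:R = (#|G|%:R + #|degree_set G k|%:R) / (k%:R + 2%:R) :> rat).
Proof.
have k2E : k%:R + 2%:R = k.+2%:R :> rat by rewrite -natrD addn2.
split=> [n G kG <-|].
  rewrite k2E ler_pdivlMr ?ltr0Sn // -natrD -natrM ler_nat.
  exact: ktree_gamma_i_bound.
have kP := path_power_ktree k k.+1.
exists (path_power k (k + k).+2); split=> //.
rewrite k2E -natrD.
suff <- : (gamma_i (path_power k (k + k).+2) * k.+2 =
    #|path_power k (k + k).+2| + #|degree_set (path_power k (k + k).+2) k|)%N.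
  by rewrite natrM mulfK ?pnatr_eq0.
(* The general bound closes a sandwich: [2(k+2)] is at most the left side, and the right side is at
   most [(2k+2) + 2]. *)
have := ktree_gamma_i_bound kP; have := path_power_gamma_i k.
have := path_power_degree_set k; rewrite addSn card_ord; nia.
Qed.
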